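(* Every second-countable Urysohn space has a $G_\delta$-diagonal. Consequently, $\mathfrak q_{2\frac12\Delta}=\mathfrak q_{2\frac12}$.
   Context: A topological space is Urysohn ($T_{2\frac12}$) if every two distinct points have disjoint closed neighborhoods. A space $X$ has a $G_\delta$-diagonal if $\Delta_X=\{(x,x):x\in X\}$ is a $G_\delta$ subset of $X^2$. A $Q$-space is a topological space in which every subset is a $G_\delta$ set. $\mathfrak q_{2\frac12}$ is the least cardinality of a second-countable Urysohn space that is not a $Q$-space. $\mathfrak q_{2\frac12\Delta}$ is the least cardinality of a second-countable Urysohn space with a $G_\delta$-diagonal that is not a $Q$-space. *)

(* Defs.v *)
(* MathComp-Analysis *)
From mathcomp Require Import all_boot.
From mathcomp Require Import boolp classical_sets functions cardinality.
From mathcomp Require Import topology borel_hierarchy.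

Set Implicit Arguments.
Unset Strict Implicit.
Unset Printing Implicit Defensive.

Local Open Scope classical_set_scope.
Local Open Scope card_scope.

(* Closed neighborhoods are closed members of the filter [nbhs x]; they need
   not be open. *)
Definition urysohn_space (X : topologicalType) : Prop :=
  forall x y : X, x <> y ->
    exists A B : set X, [/\ nbhs x A, closed A, nbhs y B, closed B &
                            A `&` B = set0].

Definition has_Gdelta_diagonal (X : topologicalType) : Prop :=
  Gdelta (@diagonal X).

(* No separation axiom is part of the definition. *)
Definition Q_space (X : topologicalType) : Prop :=
  forall A : set X, Gdelta A.

(* A cardinal is represented by any type of that cardinality:
   [is_least_cardinality P kappa] says that the least cardinality of a space
   satisfying [P] exists and equals that of [kappa]. *)
Definition is_least_cardinality (P : topologicalType -> Prop) (kappa : Type) :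
    Prop :=
  (exists2 X : topologicalType, P X & [set: X] #= [set: kappa]) /\
  (forall Y : topologicalType, P Y -> [set: kappa] #<= [set: Y]).

(* Two representatives of the least cardinality are equinumerous, so
   [exists kappa, is_least_cardinality P kappa /\ is_least_cardinality Q kappa]
   is the equality of the two cardinals. *)
Lemma is_least_cardinality_unique (P : topologicalType -> Prop)
    (kappa lambda : Type) :
  is_least_cardinality P kappa -> is_least_cardinality P lambda ->
  [set: kappa] #= [set: lambda].
Proof.
move=> [[X PX /card_eqPle[Xk _]] leP] [[Y PY /card_eqPle[Yl _]] leQ].
by apply/card_eqPle; split;
  [apply: card_le_trans (leP _ PY) Yl | apply: card_le_trans (leQ _ PX) Xk].
Qed.

Definition is_q_urysohn : Type -> Prop :=
  is_least_cardinality (fun X : topologicalType =>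
    [/\ @second_countable X, urysohn_space X & ~ Q_space X]).

Definition is_q_urysohn_diag : Type -> Prop :=
  is_least_cardinality (fun X : topologicalType =>
    [/\ @second_countable X, urysohn_space X, has_Gdelta_diagonal X &
        ~ Q_space X]).

(* Main.v *)
Require Import Defs.
From mathcomp Require Import all_boot.
From mathcomp Require Import boolp classical_sets cardinality.
From mathcomp Require Import topology borel_hierarchy.
From mathcomp Require Import all_order ssralg ssrnum interval rat.
From mathcomp Require Import functions reals normedtype Rstruct.

Set Implicit Arguments.
Unset Strict Implicit.
Unset Printing Implicit Defensive.

Import Order.TTheory GRing.Theory Num.Theory.
Import numFieldNormedType.Exports.

Local Open Scope classical_set_scope.
Local Open Scope card_scope.

(** Two points with disjoint closed neighborhoods have basic open neighborhoods
    U and V with disjoint closures. So when the base is countable, countably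
    many closed rectangles [closure U `*` closure V] cover the complement of the
    diagonal, and each of them misses the diagonal; the diagonal is the
    intersection of their open complements.

    Having a G_delta-diagonal is thus automatic, both cardinals are the least
    cardinality of the same class of spaces, and it remains to see that this
    least cardinality exists. The class is inhabited by the real line: by Baire
    category the set of rational numbers is not G_delta in it
    ([not_Q_space_real]). A nonempty class of spaces has a member of least
    cardinality ([least_cardinality_exists]) because any family of types has a
    member that injects into all the others ([card_le_family_least], a direct
    consequence of Zorn's lemma on the product of the family). *)

(** * Diagonals of second-countable Urysohn spaces *)

Lemma bigcap_open_Gdelta (T : topologicalType) (I : Type) (D : set I)
    (F : I -> set T) :
  countable D -> (forall i, D i -> open (F i)) -> Gdelta (\bigcap_(i in D) F i).
Proof.
move=> /pfcard_geP[->|[f]] oF.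
  by rewrite bigcap_set0; exact/open_Gdelta/openT.
exists (fun n => F (f n)) => [n|]; first exact/oF/funS.
apply/seteqP; split=> [x Fx n _|x Fx i Di]; first exact/Fx/funS.
by have [n _ <-] := @surj _ _ _ _ f i Di; exact: Fx.
Qed.

(** Closed rectangles, rather than the open ones [U `*` V], are used because
    their complements have to be open. *)
Lemma second_countable_urysohn_Gdelta_diagonal (X : topologicalType) :
  @second_countable X -> urysohn_space X -> has_Gdelta_diagonal X.
Proof.
move=> [B cB [oB bB]] uX; rewrite /has_Gdelta_diagonal.
pose D := [set p : set X * set X | (B p.1 /\ B p.2) /\
             closure p.1 `&` closure p.2 = set0].
pose F (p : set X * set X) : set (X * X) := ~` (closure p.1 `*` closure p.2).
have -> : @diagonal X = \bigcap_(p in D) F p.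
  apply/seteqP; split=> [[x y] xy p [_ p0] [px py]|[x y] Fxy].
    have {}xy : x = y := xy; subst y.
    by have : set0 x by rewrite -p0.
  apply: contrapT => /= /uX[C [E [xC cC yE cE CE0]]].
  have [U [BU Ux] UC] := bB x C xC.
  have [V [BV Vy] VE] := bB y E yE.
  have UVD : D (U, V).
    split=> //=; apply/seteqP; split=> // z [Uz Vz]; rewrite -CE0.
    by split; [apply: cC; exact: closureS Uz
              |apply: cE; exact: closureS Vz].
  by apply: (Fxy _ UVD); split; exact: subset_closure.
apply: bigcap_open_Gdelta.
  by apply: sub_countable (countableX cB cB); apply: subset_card_le => p [].
move=> [U V] _; rewrite /F/= openC.
rewrite (_ : _ `*` _ = fst @^-1` closure U `&` snd @^-1` closure V)//.
apply: closedI; apply: preimage_closed; try exact: closed_closure.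
  by move=> ? _; exact: cvg_fst.
by move=> ? _; exact: cvg_snd.
Qed.

(** * Existence of least cardinals *)

(** Zorn's lemma gives a maximal set S of points of the product on which every
    coordinate is injective. Some coordinate i maps S onto [T i], since
    otherwise a point whose coordinates all avoid the images of S could be added
    to S. Then [T i] is the image of S under coordinate i, and S injects into
    each [T j]. *)
Lemma card_le_family_least (I : Type) (T : I -> Type) :
  inhabited I -> exists i, forall j, [set: T i] #<= [set: T j].
Proof.
move=> [i0].
pose P (S : set (forall i, T i)) :=
  forall i (f g : forall i, T i), S f -> S g -> f i = g i -> f = g.
have [|S [PS Smax]] := @Zorn_bigcup _ P.
  move=> F FP Ftot i f g [A FA Af] [B FB Bg].
  have [AB|BA] := Ftot _ _ FA FB.
  - by apply: (FP _ FB) => //; exact: AB.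
  - by apply: (FP _ FA) => //; exact: BA.
have [[i Si]|/forallNP Sn] := pselect (exists i, forall t : T i,
    exists2 f, S f & f i = t).
  exists i => j.
  have -> : [set: T i] = (fun f => f i) @` S.
    by apply/seteqP; split=> // t _; have [f] := Si t; exists f.
  apply: card_le_trans (card_image_le _ _) _.
  have /card_eqPle[_] : (fun f : forall i, T i => f j) @` S #= S.
    by apply: inj_card_eq => f g /set_mem Sf /set_mem Sg; exact: PS.
  by move=> h; apply: card_le_trans h _; exact: subset_card_le.
(* [h] collects a missed value in each coordinate; it extends S properly. *)
have {}Sn i : {t : T i | forall f, S f -> f i <> t}.
  apply: cid; have /existsNP[t nt] := Sn i; exists t => f Sf ft.
  by apply: nt; exists f.
pose h i := projT1 (Sn i).
have hS i f : S f -> f i <> h i by exact: (projT2 (Sn i)).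
have /Smax[] : S `<` S `|` [set h].
  split=> [f Sf|/(_ h (or_intror erefl)) Sh]; first by left.
  exact: (hS i0 h Sh).
move=> i f g [Sf|->] [Sg|->] //; first exact: PS.
  by move/(hS _ _ Sf).
by move/esym/(hS _ _ Sg).
Qed.

(** Comparability of cardinals is the case of a family of two types. *)
Lemma card_le_total (T U : Type) :
  [set: T] #<= [set: U] \/ [set: U] #<= [set: T].
Proof.
have [[] le] := @card_le_family_least bool (fun b => if b then T else U)
  (inhabits true).
  by left; exact: (le false).
by right; exact: (le true).
Qed.

(** The product of all spaces satisfying [P] lives in too large a universe.
    Instead one such space X0 is fixed, and the least type is taken among the
    subsets of X0 that are equinumerous to a space satisfying [P]. By
    comparability, any other space either is equinumerous to such a subset or
    has at least the cardinality of X0. *)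
Lemma least_cardinality_exists (P : topologicalType -> Prop) :
  (exists X, P X) -> exists kappa, is_least_cardinality P kappa.
Proof.
move=> [X0 PX0].
pose I := {A : set X0 | exists2 Y : topologicalType, P Y & [set: Y] #= A}.
have X0I : exists2 Y : topologicalType, P Y & [set: Y] #= [set: X0].
  by exists X0.
have [[A [X PX XA]] leA] := @card_le_family_least I (fun i => set_type (sval i))
  (inhabits (exist _ _ X0I)).
exists X; split=> [|Y PY]; first by exists X.
have XI (i : I) : [set: X] #<= sval i.
  have /= := leA i; rewrite (card_le_eql (card_setT _)).
  by rewrite (card_le_eqr (card_setT _)) (card_le_eql XA).
have [/card_leP[f]|] := card_le_total Y X0.
  have BY : val @` range f #= [set: Y].
    apply: card_eq_trans (card_setT _).
    apply: card_eq_trans (card_image f).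
    by apply: inj_card_eq => ? ? _ _; exact: val_inj.
  have YI : exists2 Y : topologicalType, P Y & [set: Y] #= val @` range f.
    by exists Y => //; rewrite card_eq_sym.
  by have := XI (exist _ _ YI); rewrite /= (card_le_eqr BY).
exact: card_le_trans (XI (exist _ _ X0I)).
Qed.

(** * The real line *)

Local Open Scope ring_scope.

Lemma second_countable_real (R : realType) :
  @second_countable (R : topologicalType).
Proof.
exists (range (fun q : rat * rat => [set` `]ratr q.1, ratr q.2[%R] : set R)).
  by apply: sub_countable (card_image_le _ _) _; exact: countableP.
split=> [_ [q _ <-]|x A]; first exact: interval_open.
move=> /nbhs_ballP[e /= e0 xeA].
have /rat_in_itvoo[p /itvP px] : x - e < x by rewrite ltrBlDr ltrDl.
have /rat_in_itvoo[q /itvP qx] : x < x + e by rewrite ltrDl.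
exists [set` `]ratr p, ratr q[%R].
  by split; [exists (p, q)|rewrite /= in_itv /= px qx].
move=> z /=; rewrite in_itv /= => /andP[pz zq]; apply: xeA.
rewrite /ball /= distrC ltr_distl (lt_trans _ pz) ?px//.
by rewrite (lt_trans zq)// qx.
Qed.

Lemma urysohn_real (R : realType) : urysohn_space (R : topologicalType).
Proof.
have sep (x y : R) : x < y -> exists A B : set R,
    [/\ nbhs x A, closed A, nbhs y B, closed B & A `&` B = set0].
  (* With m the midpoint of x and y, and n that of m and y, the half-lines
     bounded above by m and below by n separate x from y. *)
  move=> xy; have [xm my] := midf_lt xy; have [mn ny] := midf_lt my.
  set m := _ / _ in xm my mn ny; set n := _ / _ in mn ny.
  exists [set z | z <= m], [set z | n <= z]; split.
  - by apply: filterS (lt_nbhsl xm) => z /ltW.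
  - exact: closed_le.
  - by apply: filterS (lt_nbhsr ny) => z /ltW.
  - exact: closed_ge.
  - apply/seteqP; split=> // z [/= zm nz].
    by have := lt_le_trans mn (le_trans nz zm); rewrite ltxx.
move=> x y /eqP; rewrite neq_lt => /orP[|/sep[A [B [xA cA yB cB AB]]]].
  exact: sep.
by exists B, A; rewrite setIC.
Qed.

Lemma not_Q_space_real (R : realType) : ~ Q_space (R : topologicalType).
Proof. by move=> /(_ (@rational R)); exact: not_rational_Gdelta. Qed.

Theorem lemma18 :
  (forall X : topologicalType,
     @second_countable X -> urysohn_space X -> has_Gdelta_diagonal X) /\
  (exists kappa : Type, is_q_urysohn_diag kappa /\ is_q_urysohn kappa).
Proof.
split; first exact: second_countable_urysohn_Gdelta_diagonal.
pose R : realType := Rdefinitions.R.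
have [|kappa kappaP] := @least_cardinality_exists (fun X : topologicalType =>
    [/\ @second_countable X, urysohn_space X & ~ Q_space X]).
  exists (R : topologicalType); split;
    [exact: second_countable_real|exact: urysohn_real|exact: not_Q_space_real].
exists kappa; split=> //; case: kappaP => [[X [scX uX nQX] Xk] lek].
split=> [|Y [scY uY _ nQY]]; last exact: lek.
by exists X => //; split=> //; exact: second_countable_urysohn_Gdelta_diagonal.
Qed.
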